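(* For every real quadratic form $P(x,y)=ax^2+bxy+cy^2$, $$\bigl(|a|^{4/3}+|b|^{4/3}+|c|^{4/3}\bigr)^{3/4}\le\bigl(2+2^{8/3}\bigr)^{3/4}\,\|P\|_{\mathfrak O}.$$ The factor $\bigl(2+2^{8/3}\bigr)^{3/4}$ is optimal and equals $\mathcal C_{4/3}(\mathfrak O)$. Equality is attained by $P_*(x,y)=-x^2+4xy-y^2$ and by $-P_*$.
   Context: $\mathfrak O:=\{(x,y)\in[0,1]^2: x+y\le\sqrt2\}$. For a real quadratic form $P$, $\|P\|_{\mathfrak O}:=\sup_{(x,y)\in\mathfrak O}|P(x,y)|$. The coefficient constant at exponent $4/3$ is $$\mathcal C_{4/3}(\mathfrak O):=\sup_{P\ne0}\frac{(|a|^{4/3}+|b|^{4/3}+|c|^{4/3})^{3/4}}{\|P\|_{\mathfrak O}},$$ the supremum being over nonzero real quadratic forms $P=ax^2+bxy+cy^2$. *)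

(* Defs.v *)
From HB Require Import structures.
From mathcomp Require Import all_boot all_order all_algebra.
From mathcomp Require Import all_classical all_reals all_analysis.

Set Implicit Arguments.
Unset Strict Implicit.
Unset Printing Implicit Defensive.

Import Order.TTheory GRing.Theory Num.Theory.
Import numFieldNormedType.Exports.

Local Open Scope classical_set_scope.
Local Open Scope ring_scope.

Definition Oset (R : realType) : set (R * R) :=
  [set z | [/\ 0 <= z.1 <= 1, 0 <= z.2 <= 1 & z.1 + z.2 <= Num.sqrt 2]].

(* A quadratic form is given by its coefficients; since a form is zero exactly
   when its coefficients are, nonzero forms are the triples other than 0. *)
Definition qform (R : realType) (a b c : R) (z : R * R) : R :=
  a * z.1 ^+ 2 + b * (z.1 * z.2) + c * z.2 ^+ 2.

(* The set is nonempty and bounded, so the real-valued [sup] is the supremum. *)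
Definition qform_norm (R : realType) (a b c : R) : R :=
  sup [set `|qform a b c z| | z in @Oset R].

Definition coef_norm43 (R : realType) (a b c : R) : R :=
  (`|a| `^ (4 / 3) + `|b| `^ (4 / 3) + `|c| `^ (4 / 3)) `^ (3 / 4).

(* The supremum is taken in the extended reals, so that finiteness is not built
   into the definition. The denominator is positive for a nonzero form. *)
Definition coef_const43 (R : realType) : \bar R :=
  ereal_sup [set r : \bar R | exists a b c : R,
    (a, b, c) <> (0, 0, 0) /\
    r = (coef_norm43 a b c / qform_norm a b c)%:E].

(* Main.v *)
Require Import Defs.
From HB Require Import structures.
From mathcomp Require Import all_boot all_order all_algebra.
From mathcomp Require Import all_classical all_reals all_analysis.
From mathcomp Require Import ring lra.

(* Evaluating P at (1, 0), (0, 1) and (1/sqrt 2, 1/sqrt 2) bounds |a|, |c| and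
   |a + b + c| / 2 by N = ||P||, so |b| <= 4 N; the coefficient norm is monotone
   in (|a|, |b|, |c|), and (N, 4 N, N) yields the constant. All these bounds are
   equalities for P_*, which has norm 1. *)

Set Implicit Arguments.
Unset Strict Implicit.
Unset Printing Implicit Defensive.

Import Order.TTheory GRing.Theory Num.Theory.
Import numFieldNormedType.Exports.

Local Open Scope classical_set_scope.
Local Open Scope ring_scope.

Lemma sqrt2_ge1 (R : realType) : 1 <= Num.sqrt 2 :> R.
Proof. by rewrite -[leLHS]sqrtr1 ler_sqrt // ler1n. Qed.

Lemma Oset_e1 (R : realType) : @Oset R (1, 0).
Proof. by split; rewrite /= ?addr0 ?sqrt2_ge1 ?lexx ?ler01. Qed.

Lemma Oset_e2 (R : realType) : @Oset R (0, 1).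
Proof. by split; rewrite /= ?add0r ?sqrt2_ge1 ?lexx ?ler01. Qed.

(** This is the point (1/sqrt 2, 1/sqrt 2), on the edge x + y = sqrt 2. From [s1] and [s2], sqrt 2
    <= 2, so it lies in the unit square. *)
Lemma Oset_diag (R : realType) : @Oset R (Num.sqrt 2 / 2, Num.sqrt 2 / 2).
Proof.
have s1 := sqrt2_ge1 R.
have s2 : Num.sqrt 2 ^+ 2 = 2 :> R by rewrite sqr_sqrtr.
by split=> /=; [apply/andP; split; nra..|lra].
Qed.

(** Each monomial takes values in [0, 1] on the unit square. The bound makes the set of values
    bounded above, so that its [sup] is an upper bound. *)
Lemma ler_norm_qform (R : realType) (a b c : R) (z : R * R) :
  @Oset R z -> `|qform a b c z| <= `|a| + `|b| + `|c|.
Proof.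
have le_monom (k t : R) : 0 <= t <= 1 -> `|k * t| <= `|k|.
  by case/andP=> t0 t1; rewrite normrM (ger0_norm t0) ler_piMr.
case: z => x y [/= /andP[x0 x1] /andP[y0 y1] _]; rewrite /qform /=.
apply: (le_trans (ler_normD _ _)); apply: lerD; last first.
  by apply: le_monom; rewrite exprn_ge0// exprn_ile1.
apply: (le_trans (ler_normD _ _)); apply: lerD; apply: le_monom.
  by rewrite exprn_ge0// exprn_ile1.
by rewrite mulr_ge0// mulr_ile1.
Qed.

Lemma qform_le_norm (R : realType) (a b c : R) (z : R * R) :
  @Oset R z -> `|qform a b c z| <= qform_norm a b c.
Proof.
move=> Oz; apply: ub_le_sup; last by exists z.
exists (`|a| + `|b| + `|c|) => _ [w Ow <-]; exact: ler_norm_qform.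
Qed.

Lemma qform_norm_le (R : realType) (a b c M : R) :
  (forall z, @Oset R z -> `|qform a b c z| <= M) -> qform_norm a b c <= M.
Proof.
move=> leM; apply: ge_sup; last by move=> _ [z Oz <-]; exact: leM.
(* [ge_sup] requires a nonempty set of values. *)
by exists `|qform a b c (1, 0)|; exists (1, 0) => //; exact: Oset_e1.
Qed.

Lemma qform_norm_ge0 (R : realType) (a b c : R) : 0 <= qform_norm a b c.
Proof. exact: le_trans (normr_ge0 _) (qform_le_norm _ _ _ (Oset_e1 R)). Qed.

Lemma qform_normN (R : realType) (a b c : R) :
  qform_norm (- a) (- b) (- c) = qform_norm a b c.
Proof.
rewrite /qform_norm; congr (sup _); apply: eq_imagel => z _.
by rewrite -normrN; congr (`|_|); rewrite /qform; ring.
Qed.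

Lemma coef_norm43N (R : realType) (a b c : R) :
  coef_norm43 (- a) (- b) (- c) = coef_norm43 a b c.
Proof. by rewrite /coef_norm43 !normrN. Qed.

Lemma coef_le_qform_norm (R : realType) (a b c : R) :
  let N := qform_norm a b c in [/\ `|a| <= N, `|b| <= 4 * N & `|c| <= N].
Proof.
move=> N.
have le_a : `|a| <= N.
  have := qform_le_norm a b c (Oset_e1 R).
  by congr (`|_| <= _); rewrite /qform /=; ring.
have le_c : `|c| <= N.
  have := qform_le_norm a b c (Oset_e2 R).
  by congr (`|_| <= _); rewrite /qform /=; ring.
split=> //.
(* All three monomials equal 1/2 at the diagonal point. *)
have : `|(a + b + c) / 2| <= N.
  have := qform_le_norm a b c (Oset_diag R).
  have s2 : Num.sqrt 2 ^+ 2 = 2 :> R by rewrite sqr_sqrtr.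
  have half : (Num.sqrt 2 / 2) ^+ 2 = 2^-1 :> R by rewrite expr_div_n s2; field.
  by congr (`|_| <= _); rewrite /qform /= -expr2 half; ring.
(* Since b = 2 * ((a + b + c) / 2) - a - c, the bound is 2 N + N + N. *)
move: le_a le_c; rewrite !ler_norml => /andP[? ?] /andP[? ?] /andP[? ?].
by apply/andP; split; lra.
Qed.

(** This identifies the term 2^(8/3) of the constant as the contribution of the middle coefficient
    4. *)
Lemma powR4_43 (R : realType) : 4 `^ (4 / 3) = 2 `^ (8 / 3) :> R.
Proof.
rewrite (_ : 4 `^ _ = (2 `^ 2) `^ (4 / 3)); last by rewrite powR_mulrn// -natrX.
by rewrite -powRrM; congr (_ `^ _); field.
Qed.

Lemma coef_norm43_le (R : realType) (a b c : R) :
  coef_norm43 a b c <= (2 + 2 `^ (8 / 3)) `^ (3 / 4) * qform_norm a b c.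
Proof.
have [le_a le_b le_c] := coef_le_qform_norm a b c.
have := qform_norm_ge0 a b c; set N := qform_norm a b c in le_a le_b le_c * => N0.
(* Both sides become powers with exponent 3/4, which monotonicity then strips. *)
have -> : N = (N `^ (4 / 3)) `^ (3 / 4).
  by rewrite -powRrM (_ : 4 / 3 * (3 / 4) = 1) ?powRr1//; field.
rewrite -powRM ?addr_ge0 ?powR_ge0//.
have mono (x y : R) : `|x| <= y -> `|x| `^ (4 / 3) <= y `^ (4 / 3).
  move=> xy; by apply: ge0_ler_powR; rewrite ?nnegrE// (le_trans _ xy).
apply: ge0_ler_powR; rewrite ?nnegrE ?mulr_ge0 ?addr_ge0 ?powR_ge0//.
(* The three bounds add up to 2 N^(4/3) + (4 N)^(4/3) = (2 + 2^(8/3)) N^(4/3). *)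
have := mono _ _ le_a; have := mono _ _ le_c; have := mono _ _ le_b.
by rewrite powRM// powR4_43; lra.
Qed.

Lemma qform_norm_extremal (R : realType) : qform_norm (-1) 4 (-1) = 1 :> R.
Proof.
apply/eqP; rewrite eq_le; apply/andP; split.
  apply: qform_norm_le => -[x y] [/= /andP[x0 x1] /andP[y0 y1] xy].
  (* The constraint x + y <= sqrt 2, squared, gives P_* <= (x + y)^2 / 2 <= 1. *)
  have s2 : (x + y) ^+ 2 <= 2.
    rewrite -[leRHS]sqr_sqrtr//; apply: lerXn2r => //.
      by rewrite nnegrE addr_ge0.
    by rewrite nnegrE sqrtr_ge0.
  rewrite /qform /= ler_norml; apply/andP; split; last first.
    (* P_* = (x + y)^2 / 2 - 3 (x - y)^2 / 2 *)
    by have := sqr_ge0 (x - y); nra.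
  (* If [x <= y] then [x^2 - 4 x y <= 0], so [- P_* <= y^2 <= 1]. *)
  by case: (leP x y) => [|/ltW] ?; nra.
(* Conversely, P_* takes the value -1 at (1, 0). *)
have := qform_le_norm (-1) 4 (-1) (Oset_e1 R).
by rewrite /qform /= expr1n expr0n /= !mulr0 !addr0 mulr1 normrN1.
Qed.

Lemma coef_norm43_extremal (R : realType) :
  coef_norm43 (-1) 4 (-1) = (2 + 2 `^ (8 / 3)) `^ (3 / 4) :> R.
Proof.
rewrite /coef_norm43 normrN1 powR1 ger0_norm// powR4_43.
by congr (_ `^ _); ring.
Qed.

Theorem corollary6p3 (R : realType) :
  let C : R := (2 + 2 `^ (8 / 3)) `^ (3 / 4) in
  [/\ (forall a b c : R, coef_norm43 a b c <= C * qform_norm a b c),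
      (forall K : R,
         (forall a b c : R, coef_norm43 a b c <= K * qform_norm a b c) ->
         C <= K),
      coef_const43 R = C%:E,
      coef_norm43 (-1) 4 (-1) = C * qform_norm (-1) 4 (-1)
    & coef_norm43 1 (-4) 1 = C * qform_norm 1 (-4) 1].
Proof.
move=> C.
have eqC : coef_norm43 (-1) 4 (-1) = C * qform_norm (-1) 4 (-1).
  by rewrite qform_norm_extremal mulr1 coef_norm43_extremal.
split=> //; first exact: coef_norm43_le.
(* Tested on P_*, which has norm 1, the assumed inequality reads [C <= K]. *)
- move=> K /(_ (-1) 4 (-1)).
  by rewrite eqC qform_norm_extremal !mulr1.
- apply/eqP; rewrite eq_le; apply/andP; split.
    apply: ge_ereal_sup => _ [a [b [c [_ ->]]]]; rewrite lee_fin.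
    (* If the norm is 0, the quotient is 0 by the convention [0^-1 = 0], and [C] is nonnegative;
       otherwise the denominator is cleared. *)
    have := qform_norm_ge0 a b c; rewrite le_eqVlt => /predU1P[<-|N0].
      by rewrite invr0 mulr0 powR_ge0.
    by rewrite ler_pdivrMr// coef_norm43_le.
  (* The quotient of P_* is exactly [C], so the supremum is attained. *)
  apply: ereal_sup_ubound; exists (-1), 4, (-1); split.
    by case=> /eqP; rewrite oppr_eq0 oner_eq0.
  by rewrite eqC qform_norm_extremal mulr1 divr1.
(* Both norms are even, which transfers the equality from P_* to -P_*. *)
- by rewrite -coef_norm43N -qform_normN opprK.
Qed.
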